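(* Let $G=(V,E)$ be an undirected graph on $n$ vertices. Sample each edge $e\in E$ independently with probability $p_e=\min\{50\log^2 n/rd(e),\,1\}$, where $rd(e)$ is the rounded-degree of $e$ in $G$, and let $\hat G$ be the graph on $V$ whose edges are the sampled edges. Then the following properties hold with high probability: (i) the number of edges of $\hat G$ is $O(n\log^2 n)$; and (ii) from every cut of size at least $n$ in $G$ at least one edge is sampled.
   Context: $\log$ is the base-2 logarithm. The rounded-degree of a (non-isolated) vertex $u$ is $rd(u)=2^{\lfloor \log \mathrm{degree}(u)\rfloor}$, and the rounded-degree of an edge $e=\{u,v\}$ is $rd(e)=\min\{rd(u),rd(v)\}$, with degrees taken in $G$. A cut of $G$ is the set of edges of $G$ with exactly one endpoint in $U$, for some $U\subseteq V$; its size is its number of edges. An event occurs with high probability if its probability is at least $1-1/n^c$ for a constant $c\ge 1$. The constant hidden in $O(\cdot)$ is absolute. *)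

(* Defs.v *)
From HB Require Import structures.
From mathcomp Require Import all_boot all_order all_algebra.
From mathcomp Require Import reals exp.

Set Implicit Arguments.
Unset Strict Implicit.
Unset Printing Implicit Defensive.

Import Order.TTheory GRing.Theory Num.Theory.
Local Open Scope ring_scope.

Definition log2 (R : realType) (x : R) : R := ln x / ln 2.

(* A simple undirected graph on a finite vertex type V is a symmetric and
   irreflexive relation adj; an edge is the two-element set of its endpoints. *)
Section Graph.
Variables (V : finType) (adj : rel V).

Definition edges : {set {set V}} :=
  [set [set x.1; x.2] | x : V * V & adj x.1 x.2].

Definition degree (u : V) : nat := #|[set v | adj u v]|.

Definition cut (U : {set V}) : {set {set V}} :=
  [set f in edges | #|f :&: U| == 1%N].

End Graph.

Section Sampling.
Variables (R : realType) (V : finType) (adj : rel V).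

(* Integer exponent; for an isolated vertex the value is irrelevant. *)
Definition rd_vertex (u : V) : R :=
  2 ^ Num.floor (log2 ((degree adj u)%:R : R)).

(* The value 0 is junk: an edge has exactly two endpoints, and the minimum does
   not depend on their order (rd_edgeE). *)
Definition rd_edge (f : {set V}) : R :=
  if enum f is [:: u; v] then Num.min (rd_vertex u) (rd_vertex v) else 0.

Lemma rd_edgeE (u v : V) :
  u != v -> rd_edge [set u; v] = Num.min (rd_vertex u) (rd_vertex v).
Proof.
move=> uv; rewrite /rd_edge.
have : perm_eq (enum [set u; v]) [:: u; v].
  apply: uniq_perm; rewrite ?enum_uniq //= ?inE ?uv //.
  by move=> x; rewrite mem_enum !inE.
case: (enum _) (enum_uniq [set u; v]) => [|a [|b [|c s]]] /=.
- by move=> _ /perm_size.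
- by move=> _ /perm_size.
- move=> _ /perm_mem h; have := h u; have := h v; rewrite !inE !eqxx orbT /=.
  case/orP=> /eqP ev; case/orP=> /eqP eu; move: uv; rewrite ev eu ?eqxx //.
  by rewrite minC.
- by move=> _ /perm_size.
Qed.

Definition edge_prob (f : {set V}) : R :=
  Num.min (50 * log2 (#|V|%:R : R) ^+ 2 / rd_edge f) 1.

(* Law of the random set of sampled edges when each edge f is kept independently
   with probability edge_prob f: the product of Bernoulli laws. *)
Definition sample_weight (S : {set {set V}}) : R :=
  \prod_(f in edges adj) (if f \in S then edge_prob f else 1 - edge_prob f).

Definition sample_Pr (A : pred {set {set V}}) : R :=
  \sum_(S in powerset (edges adj) | A S) sample_weight S.

End Sampling.

(* Main.v *)
Require Import Defs.
From HB Require Import structures.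
From mathcomp Require Import all_boot all_order all_algebra.
From mathcomp Require Import reals exp.
From mathcomp Require Import ring lra zify.

Set Implicit Arguments.
Unset Strict Implicit.
Unset Printing Implicit Defensive.

Import Order.TTheory GRing.Theory Num.Theory.
Local Open Scope ring_scope.

(* The size bound is Markov's inequality for 2^|S|, since the rates sum to O(n log^2 n).

   For the cuts, the sample dominates the union of about log n independent rounds
   of rate min(25 log n / rd(e), 1). Grow blocks of vertices: call a block B
   light inside the active set X if the edges from B to X \ B have total weight
   sum 1/rd < 1/4. A light block is frozen (removed from X); if no block is light,
   a round hits every block with high probability, and merging along the sampled
   edges halves the number of blocks. So after log n rounds everything is frozen.

   Freezing B loses E edges between B and X \ B, where 3E <= |B| + (number of
   edges from B to outside X). Hence |X| + |edges leaving X| pays for twice the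
   number of lost edges, and starting from X = V fewer than n edges are lost.
   A cut containing no sampled edge splits no merged block, so all its edges are
   among the lost ones. *)

(** * Random subsets of a finite set with independent inclusions *)

Section BernoulliProduct.
Variables (R : realType) (E : finType).
Implicit Types (p q : E -> R) (S C : {set E}) (A B : pred {set E}).

Definition bern_weight p S : R :=
  \prod_f (if f \in S then p f else 1 - p f).

Definition bern_Pr p A : R := \sum_(S | A S) bern_weight p S.

Definition is_bern p := forall f, 0 <= p f <= 1.

Lemma bern_weight_ge0 p S : is_bern p -> 0 <= bern_weight p S.
Proof.
move=> hp; apply: prodr_ge0 => f _; have /andP[p0 p1] := hp f.
by case: ifP; rewrite ?subr_ge0.
Qed.

(** Expanding the right side over subsets gives the left: by independence the expectation of a
    product with one factor per element factorizes. Total mass, the probability of missing a set and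
    the mean of [2 ^+ #|S|] are instances. *)
Lemma sum_bern_weight_prod p (g h : E -> R) :
  \sum_S bern_weight p S * \prod_f (if f \in S then g f else h f)
  = \prod_f (p f * g f + (1 - p f) * h f).
Proof.
rewrite (bigA_distr _ _ (fun f => p f * g f) (fun f => (1 - p f) * h f)).
apply: eq_bigr => S _; rewrite -big_split /=; apply: eq_bigr => f _.
by case: ifP.
Qed.

Lemma sum_bern_weight p : \sum_S bern_weight p S = 1.
Proof.
have := sum_bern_weight_prod p (fun=> 1) (fun=> 1).
rewrite [RHS]big1 => [|f _]; last by ring.
move=> <-; apply: eq_bigr => S _; rewrite [X in _ * X]big1 ?mulr1 // => f _.
by case: ifP.
Qed.

Lemma bern_Pr_ind p A : bern_Pr p A = \sum_S bern_weight p S * (A S)%:R.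
Proof.
rewrite /bern_Pr big_mkcond; apply: eq_bigr => S _.
by case: (A S); rewrite ?mulr1 ?mulr0.
Qed.

Lemma bern_Pr_ge0 p A : is_bern p -> 0 <= bern_Pr p A.
Proof. by move=> hp; apply: sumr_ge0 => S _; apply: bern_weight_ge0. Qed.

Lemma bern_PrC p A : bern_Pr p A = 1 - bern_Pr p (predC A).
Proof. by rewrite -(sum_bern_weight p) (bigID A) /= addrK. Qed.

Lemma bern_Pr_sub p A B :
  is_bern p -> (forall S, A S -> B S) -> bern_Pr p A <= bern_Pr p B.
Proof.
move=> hp AB; rewrite !bern_Pr_ind; apply: ler_sum => S _.
apply: ler_wpM2l; first exact: bern_weight_ge0.
by case: (A S) (AB S) => [->|_] //; rewrite ler0n.
Qed.

Lemma bern_PrU p A B : is_bern p ->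
  bern_Pr p (predU A B) <= bern_Pr p A + bern_Pr p B.
Proof.
move=> hp; rewrite !bern_Pr_ind -big_split /=; apply: ler_sum => S _.
rewrite -mulrDr; apply: ler_wpM2l; first exact: bern_weight_ge0.
by rewrite -natrD ler_nat; case: (A S); case: (B S).
Qed.

Lemma bern_Pr_bigU p (I : finType) (P : {set I}) (A : I -> pred {set E}) :
  is_bern p ->
  bern_Pr p (fun S => [exists i in P, A i S]) <= \sum_(i in P) bern_Pr p (A i).
Proof.
move=> hp; under [leRHS]eq_bigr do rewrite bern_Pr_ind.
rewrite exchange_big /= bern_Pr_ind; apply: ler_sum => S _.
rewrite -mulr_sumr; apply: ler_wpM2l; first exact: bern_weight_ge0.
case: existsP => [[i /andP[iP Ai]]|_]; last by apply: sumr_ge0 => i _; exact: ler0n.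
by rewrite (bigD1 i) //= Ai lerDl; apply: sumr_ge0 => j _; exact: ler0n.
Qed.

Lemma bern_Pr_disjoint p C :
  bern_Pr p (fun S => [disjoint S & C]) = \prod_(f in C) (1 - p f).
Proof.
rewrite bern_Pr_ind.
have -> : \prod_(f in C) (1 - p f)
  = \prod_f (p f * (f \notin C)%:R + (1 - p f) * 1).
  rewrite big_mkcond; apply: eq_bigr => f _.
  by case: (f \in C); rewrite /=; ring.
rewrite -sum_bern_weight_prod; apply: eq_bigr => S _; congr (_ * _).
rewrite disjoint_subset; case: (boolP (S \subset _)) => [/subsetP SC|].
  by rewrite big1 // => f _; case: ifP => // /SC; rewrite inE => ->.
by case/subsetPn => f fS; rewrite inE => fC; rewrite (bigD1 f) //= fS (negPf fC) mul0r.
Qed.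

Lemma bern_expect_pow2 p :
  \sum_S bern_weight p S * 2 ^+ #|S| = \prod_f (1 + p f).
Proof.
have -> : \prod_f (1 + p f) = \prod_f (p f * 2 + (1 - p f) * 1).
  by apply: eq_bigr => f _; ring.
rewrite -sum_bern_weight_prod; apply: eq_bigr => S _; congr (_ * _).
by rewrite -big_mkcond prodr_const.
Qed.

(* The union of independent samples with rates p and q is a sample with rate r,
   where 1 - r = (1 - p)(1 - q). *)
Lemma bern_union p q r (g : {set E} -> R) :
  (forall f, 1 - r f = (1 - p f) * (1 - q f)) ->
  \sum_S bern_weight r S * g S =
  \sum_S bern_weight p S * \sum_S' bern_weight q S' * g (S :|: S').
Proof.
move=> hr.
transitivity (\sum_S bern_weight p S * \sum_S' bern_weight q S' *
                \sum_T (T == S :|: S')%:R * g T); last first.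
  apply: eq_bigr => S _; congr (_ * _); apply: eq_bigr => S' _; congr (_ * _).
  rewrite (bigD1 (S :|: S')) //= eqxx mul1r big1 ?addr0 // => T /negPf ->.
  by rewrite mul0r.
under [RHS]eq_bigr do under eq_bigr do rewrite mulr_sumr.
under [RHS]eq_bigr do rewrite exchange_big mulr_sumr /=.
rewrite exchange_big /=; apply: eq_bigr => T _.
(* Being the union is a condition on each element separately, so the indicator is a product and the
   sum over [S'] factorizes. *)
have indE S S' : (T == S :|: S')%:R =
  \prod_f (if f \in S' then (f \in T)%:R else ((f \in S) == (f \in T))%:R) :> R.
  case: eqP => [->|/eqP].
    by rewrite big1 // => f _; rewrite !inE; case: (f \in S'); case: (f \in S).
  rewrite eqEsubset negb_and; case/orP => /subsetPn[f]; rewrite inE.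
    rewrite negb_or => fT /andP[/negPf fS /negPf fS'].
    by rewrite (bigD1 f) //= fS' fS fT mul0r.
  move=> fSS' /negPf fT; rewrite (bigD1 f) //= fT.
  by case: (f \in S') fSS'; rewrite ?orbF => fS; rewrite ?fS mul0r.
transitivity (\sum_S bern_weight p S *
  \prod_f (q f * (f \in T)%:R + (1 - q f) * ((f \in S) == (f \in T))%:R) * g T); last first.
  apply: eq_bigr => S _; rewrite -sum_bern_weight_prod -mulrA mulr_suml.
  congr (_ * _); apply: eq_bigr => S' _.
  by rewrite indE mulrA.
rewrite -mulr_suml; congr (_ * _).
have -> : bern_weight r T = \prod_f (p f * (f \in T)%:R +
    (1 - p f) * (q f * (f \in T)%:R + (1 - q f) * (f \notin T)%:R)).
  apply: eq_bigr => f _; move: (hr f); case: (f \in T) => /= h; last by rewrite h; ring.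
  have -> : r f = 1 - (1 - p f) * (1 - q f) by rewrite -h; ring.
  by ring.
rewrite -sum_bern_weight_prod; apply: eq_bigr => S _; congr (_ * _).
by apply: eq_bigr => f _; case: (f \in S); case: (f \in T) => /=; ring.
Qed.

End BernoulliProduct.

(** * Edge counts between vertex sets, and light blocks *)

Section CrossingPairs.
Variables (V : finType) (adj : rel V).
Hypotheses (adj_sym : symmetric adj) (adj_irr : irreflexive adj).
Implicit Types (A B C X U : {set V}) (S : {set {set V}}).

Definition nbrs (x : V) B : nat := \sum_(y in B) adj x y.

(** Counts ordered pairs, which for disjoint [A] and [B] gives the number of edges between them. *)
Definition ecount A B : nat := \sum_(x in A) nbrs x B.

Definition between A B : {set {set V}} :=
  [set [set p.1; p.2] | p : V * V & [&& p.1 \in A, p.2 \in B & adj p.1 p.2]].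

Lemma nbrsID x C B : nbrs x B = (nbrs x (B :&: C) + nbrs x (B :\: C))%N.
Proof. by rewrite /nbrs (big_setID C). Qed.

Lemma nbrs_leq_card x B : (nbrs x B <= #|B|)%N.
Proof. by rewrite -sum1_card; apply: leq_sum => y _; apply: leq_b1. Qed.

Lemma nbrsT x : nbrs x setT = degree adj x.
Proof.
rewrite /degree -sum1_card big_mkcond /=; rewrite /nbrs.
by apply: eq_big => y; rewrite !inE //; case: (adj x y).
Qed.

Lemma ecountC A B : ecount A B = ecount B A.
Proof.
rewrite /ecount /nbrs exchange_big; apply: eq_bigr => y _.
by apply: eq_bigr => x _; rewrite adj_sym.
Qed.

Lemma ecountIDl C A B :
  ecount A B = (ecount (A :&: C) B + ecount (A :\: C) B)%N.
Proof. by rewrite /ecount (big_setID C). Qed.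

Lemma ecountIDr C A B :
  ecount A B = (ecount A (B :&: C) + ecount A (B :\: C))%N.
Proof. by rewrite ![ecount A _]ecountC -ecountIDl. Qed.

Lemma ecountS A A' B B' :
  A \subset A' -> B \subset B' -> (ecount A B <= ecount A' B')%N.
Proof.
move=> /setIidPr hA /setIidPr hB.
by rewrite (ecountIDl A A') (ecountIDr B _ B') hA hB -addnA leq_addr.
Qed.

Lemma ecount0l B : ecount set0 B = 0%N.
Proof. by rewrite /ecount big_set0. Qed.

Lemma ecount0r A : ecount A set0 = 0%N.
Proof. by rewrite ecountC ecount0l. Qed.

(** A cut edge meets [U] in a single vertex, so it comes from a pair ordered from inside to
    outside. *)
Lemma card_cut_leq U : (#|cut adj U| <= ecount U (~: U))%N.
Proof.
pose P := [set p : V * V | [&& p.1 \in U, p.2 \notin U & adj p.1 p.2]].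
have -> : ecount U (~: U) = #|P|.
  rewrite /ecount /nbrs pair_big_dep -sum1_card /= !big_mkcond /=.
  rewrite [in RHS]big_mkcond /=; apply: eq_bigr => -[x y] _; rewrite !inE /=.
  by case: (x \in U); case: (y \in U); case: (adj x y).
apply: leq_trans (leq_imset_card (fun p => [set p.1; p.2]) P).
apply/subset_leq_card/subsetP => f; rewrite inE => /andP[/imsetP[[x y]]].
rewrite inE /= => xy -> /cards1P[z /setP hz].
have inU w : w \in [set x; y] -> (w \in U) = (w == z).
  by move=> wxy; have := hz w; rewrite in_setI wxy in_set1.
have yx : y != x by apply: contraTneq xy => ->; rewrite adj_irr.
have : z \in [set x; y] by have := hz z; rewrite !inE eqxx => /andP[].
rewrite !inE => /orP[] /eqP zE; move: inU; rewrite zE => inU.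
  by apply/imsetP; exists (x, y); rewrite // inE /= !inU ?inE ?eqxx ?orbT //= yx.
apply/imsetP; exists (y, x); rewrite /= ?[[set y; x]]setUC //.
by rewrite inE /= !inU ?inE ?eqxx ?orbT //= eq_sym yx adj_sym.
Qed.

Lemma degree_split x B X : B \subset X ->
  (degree adj x <= nbrs x B + nbrs x (X :\: B) + nbrs x (~: X))%N.
Proof.
move=> /setIidPr BX; rewrite -nbrsT (nbrsID x X) (nbrsID x B (setT :&: X)).
by rewrite setTI BX setTD.
Qed.

(* The neighbours inside the block number at most #|B|, so a vertex of large
   degree in a block of small outgoing weight sends many edges outside X. *)
Lemma light_block_ecount (R : realFieldType) (r : V -> R) B X :
  (forall x y, adj x y -> 0 < r x <= (degree adj x)%:R) ->
  B \subset X ->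
  \sum_(x in B) (nbrs x (X :\: B))%:R / r x < 1 / 4 ->
  (3 * ecount B (X :\: B) <= #|B| + ecount B (~: X))%N.
Proof.
move=> hr BX light.
have r_pos x : (0 < nbrs x (X :\: B))%N -> 0 < r x <= (degree adj x)%:R.
  rewrite lt0n sum_nat_eq0; case/forallPn => y; rewrite negb_imply => /andP[_].
  by rewrite eqb0 negbK; apply: hr.
have [->|Epos] := posnP (ecount B (X :\: B)); first by rewrite muln0.
have /exists_inP[u0 u0B hu0] : [exists x in B, (0 < nbrs x (X :\: B))%N].
  move: Epos; rewrite lt0n sum_nat_eq0; case/forallPn => x.
  by rewrite negb_imply -lt0n => /andP[xB hx]; apply/exists_inP; exists x.
pose P x := (x \in B) && (0 < nbrs x (X :\: B))%N.
have Pu0 : P u0 by rewrite /P u0B.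
(* Among the vertices of the block with a neighbour in [X :\: B], take [u] of maximal degree: each
   [r x] in a nonzero term of the weight is then at most [degree adj u]. *)
case: (@arg_maxnP _ u0 P (degree adj) Pu0) => u /andP[uB hu] umax.
have /andP[ru0 rud] := r_pos u hu.
have degu : 0 < (degree adj u)%:R :> R by apply: lt_le_trans rud.
have E_le : (ecount B (X :\: B))%:R <=
    (degree adj u)%:R * \sum_(x in B) (nbrs x (X :\: B))%:R / r x.
  rewrite /ecount natr_sum mulr_sumr; apply: ler_sum => x xB.
  have [->|hx] := posnP (nbrs x (X :\: B)); first by rewrite mul0r mulr0.
  have /andP[rx rxd] := r_pos x hx.
  rewrite mulrCA ler_peMr ?ler0n // ler_pdivlMr // mul1r.
  by apply: le_trans rxd _; rewrite ler_nat; apply: umax; rewrite /P xB.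
have : (4 * ecount B (X :\: B) < degree adj u)%N.
  rewrite -(ltr_nat R) natrM; move: E_le light degu.
  set w := \sum_(x in B) _; set E := (ecount _ _)%:R; set d := (degree _ _)%:R.
  by move=> *; nra.
(* With [E] for the edges lost: [4 * E < degree adj u <= #|B| + E + ecount B (~: X)]. *)
have := degree_split u BX; have := nbrs_leq_card u B.
have nbrs_leq C : (nbrs u C <= ecount B C)%N by rewrite /ecount (bigD1 u) ?leq_addr.
have := nbrs_leq (X :\: B); have := nbrs_leq (~: X); lia.
Qed.


(** * Cuts that escape the sample, and the effect of freezing a block *)

Definition consistent X (f : V -> V) U : bool :=
  [forall x in X, forall y in X, (f x == f y) ==> ((x \in U) == (y \in U))].

Definition avoids U S : bool :=
  [forall x in U, forall y in ~: U, adj x y ==> ([set x; y] \notin S)].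

(** The failure event. Blocks are the fibres of [f] on [X]; some [U] that splits no block and cuts
    no sampled edge cuts more edges inside [X] than half the potential [#|X| + ecount X (~: X)]. *)
Definition violated X (f : V -> V) S : bool :=
  [exists U, [&& consistent X f U, avoids U S &
    (#|X| + ecount X (~: X) < 2 * ecount (X :&: U) (X :\: U))%N]].

Definition block X (f : V -> V) a : {set V} := [set x in X | f x == a].

Lemma consistentP X f U : reflect
  {in X &, forall x y, f x = f y -> (x \in U) = (y \in U)} (consistent X f U).
Proof.
apply: (iffP forall_inP) => [h x y xX yX fxy|h x xX].
  by have /forall_inP/(_ y yX) := h x xX; rewrite fxy eqxx => /eqP.
by apply/forall_inP => y yX; apply/implyP => /eqP fxy; rewrite (h x y).
Qed.

Lemma avoidsP U S : reflect
  (forall x y, x \in U -> y \notin U -> adj x y -> [set x; y] \notin S)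
  (avoids U S).
Proof.
apply: (iffP forall_inP) => [h x y xU yU|h x xU].
  by have /forall_inP/(_ y) := h x xU; rewrite inE => /(_ yU)/implyP.
by apply/forall_inP => y; rewrite inE => yU; apply/implyP; apply: h.
Qed.

(** A single block lies on one side of [U], so no edge inside [X] is cut. *)
Lemma violated_single X f S : (#|f @: X| <= 1)%N -> ~~ violated X f S.
Proof.
move=> /card_le1_eqP h; apply/existsPn => U; apply/negP.
case/and3P => /consistentP cU _; apply/negP; rewrite -leqNgt.
have hU : {in X &, forall x y, (x \in U) = (y \in U)}.
  by move=> x y xX yX; apply: cU => //; apply: h; apply: imset_f.
suff -> : ecount (X :&: U) (X :\: U) = 0%N by [].
have [->|[x]] := set_0Vmem (X :&: U); first exact: ecount0l.
rewrite inE => /andP[xX xU].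
suff -> : X :\: U = set0 by exact: ecount0r.
by apply/setP => y; rewrite !inE; case: (boolP (y \in X)) => yX; rewrite ?andbF // -(hU x) ?xU.
Qed.

(** Let [B] be the block and [E] the number of edges from it to the rest of [X]. Freezing lowers the
    potential by [#|B| + ecount B (~: X) - E >= 2 * E] and loses at most [E] cut edges, so the
    violation persists. *)
Lemma violated_remove_block X f S a :
  (3 * ecount (block X f a) (X :\: block X f a)
     <= #|block X f a| + ecount (block X f a) (~: X))%N ->
  violated X f S -> violated (X :\: block X f a) f S.
Proof.
set B := block X f a; move=> light /existsP[U /and3P[/consistentP cU aU big]].
have BX : B \subset X by apply/subsetP => x; rewrite inE => /andP[].
have BXI : X :&: B = B by apply/setIidPr.
apply/existsP; exists U; rewrite aU /=; apply/andP; split.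
  by apply/consistentP => x y; rewrite !in_setD => /andP[_ xX] /andP[_ yX]; apply: cU.
have cardX : #|X| = (#|B| + #|X :\: B|)%N by rewrite -{1}(cardsID B X) BXI.
have bdX : ecount X (~: X) = (ecount B (~: X) + ecount (X :\: B) (~: X))%N.
  by rewrite (ecountIDl B) BXI.
have bdX' : ecount (X :\: B) (~: (X :\: B)) =
            (ecount (X :\: B) (~: X) + ecount B (X :\: B))%N.
  rewrite (ecountIDr X) addnC [ecount B _]ecountC; congr (ecount _ _ + ecount _ _)%N.
    by apply/setP => x; rewrite !inE; case: (x \in X); rewrite ?andbF.
  apply/setP => x; rewrite !inE; case: (x \in X); rewrite ?andbF ?andbT //=.
  by rewrite negbK.
suff : (ecount (X :&: U) (X :\: U) <=
    ecount ((X :\: B) :&: U) ((X :\: B) :\: U) + ecount B (X :\: B))%N by lia.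
have hB x y : x \in B -> y \in B -> (x \in U) = (y \in U).
  by rewrite !inE => /andP[xX /eqP fx] /andP[yX /eqP fy]; apply: cU; rewrite ?fx.
rewrite (ecountIDl (X :\: B)) (ecountIDr (X :\: B) (_ :&: (X :\: B))).
have -> : X :&: U :&: (X :\: B) = (X :\: B) :&: U.
  by apply/setP => x; rewrite !inE; case: (x \in X); case: (x \in U); rewrite ?andbF ?andbT.
have -> : (X :\: U) :&: (X :\: B) = (X :\: B) :\: U.
  by apply/setP => x; rewrite !inE; case: (x \in X); case: (x \in U); rewrite ?andbF ?andbT.
rewrite -addnA leq_add2l.
(* The block lies inside [U] or misses it; either way the lost cut edges run between [B] and
   [X :\: B]. *)
have [BU|] := boolP (B \subset U).
  have -> : (X :\: U) :\: (X :\: B) = set0.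
    apply/setP => x; rewrite !in_setD in_set0 negb_and negbK.
    case: (boolP (x \in B)) => [/(subsetP BU) -> //|_] /=.
    by case: (x \in X); rewrite ?andbF.
  rewrite ecount0r add0n; apply: ecountS.
    apply/subsetP => x; rewrite !in_setD in_setI negb_and negbK.
    by case: (x \in B); case: (x \in X).
  apply/subsetP => x; rewrite !in_setD => /andP[xU ->]; rewrite andbT.
  by apply: contra xU; apply: (subsetP BU).
case/subsetPn => z zB zU.
have BU x : x \in B -> x \notin U by move=> xB; rewrite (hB x z).
have -> : (X :&: U) :\: (X :\: B) = set0.
  apply/setP => x; rewrite !in_setD in_setI in_set0 negb_and negbK.
  case: (boolP (x \in B)) => [/BU/negPf -> |_] /=; first by rewrite andbF.
  by case: (x \in X).
rewrite ecount0l addn0 ecountC; apply: ecountS; last exact: subsetIl.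
apply/subsetP => x; rewrite !in_setD negb_and negbK.
by case: (x \in B); case: (x \in X); rewrite ?andbF.
Qed.

(** * Merging blocks along sampled edges *)

Definition linked X (f : V -> V) S : rel V := fun a b =>
  [exists x in X, exists y in X,
    [&& adj x y, [set x; y] \in S, f x == a & f y == b]].

(** The new label is the canonical root of the old label's component in the graph of blocks joined
    by sampled edges. *)
Definition merge_blocks X f S : V -> V := fun x => fingraph.root (linked X f S) (f x).

Lemma linkedP X f S a b : reflect
  (exists x y, [/\ x \in X, y \in X, adj x y, [set x; y] \in S & f x = a /\ f y = b])
  (linked X f S a b).
Proof.
apply: (iffP exists_inP) => [[x xX /exists_inP[y yX]]|[x [y [xX yX xy xyS [fx fy]]]]].
  by case/and4P => xy xyS /eqP fx /eqP fy; exists x, y.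
by exists x => //; apply/exists_inP; exists y => //; rewrite xy xyS fx fy !eqxx.
Qed.

Lemma linked_csym X f S : connect_sym (linked X f S).
Proof.
apply: sym_connect_sym => a b.
by apply/linkedP/linkedP => -[x [y [xX yX xy xyS [fx fy]]]];
   exists y, x; rewrite adj_sym setUC; split.
Qed.

(** A cut avoiding [S] never separates linked blocks, so it splits no merged block. [S] is spent on
    merging; [S'] is left for later rounds. *)
Lemma violated_merge X f S S' :
  violated X f (S :|: S') -> violated X (merge_blocks X f S) S'.
Proof.
case/existsP => U /and3P[/consistentP cU /avoidsP aU big].
apply/existsP; exists U; rewrite big andbT; apply/andP; split; last first.
  apply/avoidsP => x y xU yU xy; have := aU x y xU yU xy.
  by rewrite inE negb_or => /andP[].
(* The labels of the blocks inside [U]; closed under links, hence a union of components. *)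
pose L := [set a | [exists x in X, (f x == a) && (x \in U)]].
have fL x : x \in X -> (f x \in L) = (x \in U).
  move=> xX; rewrite inE; apply/exists_inP/idP => [[y yX /andP[/eqP yx yU]]|xU].
    by rewrite (cU x y).
  by exists x; rewrite ?eqxx.
have clL : closed (linked X f S) [in L].
  apply: intro_closed; first exact: linked_csym.
  move=> a b /linkedP[x [y [xX yX xy xyS [<- <-]]]]; rewrite !fL // => xU.
  apply/negPn/negP => yU; have := aU x y xU yU xy.
  by rewrite inE xyS.
apply/consistentP => x y xX yX /eqP; rewrite /merge_blocks root_connect; last exact: linked_csym.
by move/(closed_connect clL); rewrite !fL.
Qed.

Lemma leq_double_card_imset (T : finType) (h : T -> T) (A : {set T}) :
  {in A, forall a, exists b, [/\ b \in A, b != a & h b = h a]} ->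
  (2 * #|h @: A| <= #|A|)%N.
Proof.
move=> pair; rewrite -[#|A|]sum1_card (partition_big_imset h) /= mulnC -sum_nat_const.
apply: leq_sum => _ /imsetP[a aA ->]; have [b [bA ba hb]] := pair a aA.
rewrite (bigD1 a) ?aA //= (bigD1 b) /= ?bA ?hb ?eqxx ?ba //.
Qed.

(** Each block is linked to a different one, so every component contains at least two labels. *)
Lemma card_merge X f S :
  (forall a, a \in f @: X ->
     ~~ [disjoint S & between (block X f a) (X :\: block X f a)]) ->
  (2 * #|merge_blocks X f S @: X| <= #|f @: X|)%N.
Proof.
move=> hit; rewrite /merge_blocks imset_comp; apply: leq_double_card_imset => a aX.
have /pred0Pn[g /andP[/= gS /imsetP[[x y]]]] := hit a aX.
rewrite inE /= => /and3P[]; rewrite !inE.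
case/andP=> xX /eqP fx; rewrite negb_and => /andP[ya yX] xy gE.
exists (f y); split; first exact: imset_f.
  by move: ya; rewrite yX.
apply/eqP; rewrite root_connect; last exact: linked_csym.
rewrite linked_csym; apply: connect1; apply/linkedP; exists x, y; split => //.
by rewrite -gE.
Qed.

End CrossingPairs.

Local Notation expR := sequences.expR.

(** * Failure probability over successive sampling rounds *)

Section Rounds.
Variables (R : realType) (V : finType) (adj : rel V).
Hypothesis adj_sym : symmetric adj.
Variables (r : V -> R) (p : {set V} -> R) (delta : R).
Hypothesis r_bounds : forall x y, adj x y -> 0 < r x <= (degree adj x)%:R.
Hypothesis p_bern : is_bern p.
Hypothesis delta_ge0 : 0 <= delta.
Hypothesis heavy_block_missed : forall X B : {set V}, B \subset X ->
  1 / 4 <= \sum_(x in B) (nbrs adj x (X :\: B))%:R / r x ->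
  \prod_(f in between adj B (X :\: B)) (1 - p f) <= delta.

(** Splits one round of rate [p] off a sample dominating [T.+1] rounds; the rest, with miss
    probability [(1 - q f) / (1 - p f)], dominates [T] rounds. *)
Lemma bern_complement q T : is_bern q ->
  (forall f, 1 - q f <= (1 - p f) ^+ T.+1) ->
  exists q', [/\ is_bern q', forall f, 1 - q f = (1 - p f) * (1 - q' f) &
                 forall f, 1 - q' f <= (1 - p f) ^+ T].
Proof.
(* Where p f = 1, also q f = 1, and the junk value 0 / 0 = 0 is the right one. *)
move=> hq hqT; exists (fun f => 1 - (1 - q f) / (1 - p f)).
have key f : [/\ 0 <= (1 - q f) / (1 - p f) <= 1,
    1 - q f = (1 - p f) * ((1 - q f) / (1 - p f)) &
    (1 - q f) / (1 - p f) <= (1 - p f) ^+ T].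
  have /andP[q0 q1] := hq f; have /andP[p0 p1] := p_bern f.
  have := hqT f; rewrite exprS.
  have [->|pn1] := eqVneq (p f) 1.
    rewrite subrr mul0r => hle; have -> : q f = 1 by lra.
    by rewrite subrr !mul0r lexx ler01 exprn_ge0.
  have ppos : 0 < 1 - p f by rewrite subr_gt0 lt_neqAle pn1.
  move=> hle; have hle' : (1 - q f) / (1 - p f) <= (1 - p f) ^+ T.
    by rewrite ler_pdivrMr // mulrC.
  split => //; last by rewrite mulrC divfK // gt_eqF.
  rewrite divr_ge0 ?(ltW ppos) ?subr_ge0 //=.
  apply: le_trans hle' _; apply: exprn_ile1; lra.
split => f; have [/andP[h0 h1] h2 h3] := key f.
- by rewrite subr_ge0 h1 /= gerBl.
- by rewrite subKr.
- by rewrite subKr.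
Qed.

(** Let [m] be the number of blocks. Freezing a light block lowers [m] and costs no round. Otherwise
    one round misses some block with probability at most [m * delta]; if it misses none, [m] at
    least halves and the later rounds add at most [2 * (m / 2) * delta]. *)
Lemma bern_violated T (X : {set V}) (f : V -> V) q : is_bern q ->
  (forall g, 1 - q g <= (1 - p g) ^+ T) -> (#|f @: X| <= 2 ^ T)%N ->
  bern_Pr q (violated adj X f) <= 2 * #|f @: X|%:R * delta.
Proof.
(* The induction is on the number of blocks, since freezing leaves [T] unchanged. *)
have [k] := ubnP #|f @: X|.
elim: k => // k IH in T X f q * => hk hq hqT hT.
have [small|big] := leqP #|f @: X| 1.
  rewrite /bern_Pr big_pred0 => [|S]; last exact/negbTE/violated_single.
  by rewrite !mulr_ge0.
have [/exists_inP[a aX light]|] := boolP [exists a in f @: X,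
  \sum_(x in block X f a) (nbrs adj x (X :\: block X f a))%:R / r x < 1 / 4].
  have BX : block X f a \subset X by apply/subsetP => x; rewrite inE => /andP[].
  apply: le_trans (bern_Pr_sub (B := violated adj (X :\: block X f a) f) hq _) _.
    by move=> S; apply/violated_remove_block/(light_block_ecount r_bounds).
  have ltX : (#|f @: (X :\: block X f a)| < #|f @: X|)%N.
    apply/proper_card/properP; split; first exact/imsetS/subsetDl.
    exists a => //; apply/imsetP => -[x]; rewrite !inE => /andP[+ xX] fx.
    by rewrite xX fx eqxx.
  apply: le_trans (IH T _ _ _ _ hq hqT _) _.
  - exact: leq_trans ltX _.
  - exact: leq_trans (ltnW ltX) hT.
  - by rewrite ler_wpM2r // ler_wpM2l // ler_nat ltnW.
move/exists_inPn => heavy.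
(* At least two blocks remain, so the bound by [2 ^ T] leaves a round to spend. *)
case: T => [|T] in hqT hT *; first by rewrite leqNgt big in hT.
have [q' [hq' hqq' hq'T]] := bern_complement hq hqT.
pose missed (S : {set {set V}}) := [exists a in f @: X,
  [disjoint S & between adj (block X f a) (X :\: block X f a)]].
(* Given the first round [S]: the trivial bound 1 if a block was missed, the induction hypothesis
   otherwise. *)
have step S : \sum_S' bern_weight q' S' * (violated adj X f (S :|: S'))%:R
    <= (missed S)%:R + #|f @: X|%:R * delta.
  have [miss|hit] := boolP (missed S).
    apply: le_trans (_ : \sum_S' bern_weight q' S' <= _); last first.
      by rewrite sum_bern_weight lerDl mulr_ge0.
    apply: ler_sum => S' _.
    by apply: ler_piMr; [exact: bern_weight_ge0 | rewrite lern1 leq_b1].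
  have card2 : (2 * #|merge_blocks adj X f S @: X| <= #|f @: X|)%N.
    apply: card_merge => // a aX.
    by move/exists_inPn: hit => /(_ a aX).
  rewrite add0r.
  apply: le_trans (_ : bern_Pr q' (violated adj X (merge_blocks adj X f S)) <= _).
    rewrite bern_Pr_ind; apply: ler_sum => S' _.
    apply: ler_wpM2l; first exact: bern_weight_ge0.
    rewrite ler_nat; case: (boolP (violated adj X f (S :|: S'))) => //.
    by move/violated_merge => ->.
  apply: le_trans (IH T _ _ _ _ hq' hq'T _) _.
  - lia.
  - by move: hT; rewrite expnS; lia.
  - by rewrite ler_wpM2r // -natrM ler_nat.
rewrite bern_Pr_ind (bern_union _ hqq').
apply: le_trans (_ : bern_Pr p missed + #|f @: X|%:R * delta <= _).
  have -> : #|f @: X|%:R * delta =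
      \sum_S bern_weight p S * (#|f @: X|%:R * delta).
    by rewrite -mulr_suml sum_bern_weight mul1r.
  rewrite bern_Pr_ind -big_split /=; apply: ler_sum => S _.
  by rewrite -mulrDr; apply: ler_wpM2l; [exact: bern_weight_ge0 | exact: step].
rewrite -mulrA [2 * _]mulr_natl mulr2n lerD2r.
apply: le_trans (bern_Pr_bigU _ _ p_bern) _.
rewrite mulr_natl -sumr_const; apply: ler_sum => a aX.
rewrite bern_Pr_disjoint; apply: heavy_block_missed.
  by apply/subsetP => x; rewrite inE => /andP[].
by rewrite leNgt; apply: heavy.
Qed.

End Rounds.

(** * Numerical estimates for logarithms, rounded degrees and rates *)

Section Estimates.
Variables (R : realType).

(** Both bounds are [ln (1 + x) <= x], at [x = 1] and at [x = - (1 / 2)]. *)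
Lemma ln2_bounds : 1 / 2 <= ln (2 : R) <= 1.
Proof.
apply/andP; split; last first.
  by have := @le_ln1Dx R 1; rewrite -[1 + 1]/(2 : R); apply; lra.
have /(_ _)/= := @le_ln1Dx R (- (1 / 2)); have -> : 1 - 1 / 2 = 2^-1 :> R by lra.
rewrite lnV ?posrE //; move=> h; suff : - ln 2 <= - (1 / 2) :> R by lra.
by apply: h; lra.
Qed.

Lemma ln2_gt0 : 0 < ln (2 : R).
Proof. by have := ln2_bounds; lra. Qed.

Lemma log2_le_natl (k d : nat) : (0 < d)%N ->
  (k%:R <= log2 (d%:R : R)) = (2 ^ k <= d)%N.
Proof.
move=> d0; rewrite /log2 ler_pdivlMr ?ln2_gt0 // mulr_natl -lnXn //.
by rewrite ler_ln ?posrE ?exprn_gt0 ?ltr0n // -natrX ler_nat.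
Qed.

Lemma rd_vertex_bounds (V : finType) (adj : rel V) u : (0 < degree adj u)%N ->
  [/\ 0 < rd_vertex R adj u, rd_vertex R adj u <= (degree adj u)%:R &
      (degree adj u)%:R <= 2 * rd_vertex R adj u].
Proof.
move=> d0; rewrite /rd_vertex; set d := degree adj u.
have /andP[lo hi] := floor_itv (log2 (d%:R : R)).
(* The degree is at least 1, so the integer exponent is a natural number. *)
have : 0 <= Num.floor (log2 (d%:R : R)).
  by rewrite floor_ge0 (log2_le_natl 0) // expn0.
case: (Num.floor _) lo hi => // m lo hi _.
rewrite -[2 ^ m]/(2 ^+ m); split; first exact: exprn_gt0.
  by rewrite -natrX ler_nat -(log2_le_natl m).
rewrite -exprS -natrX ler_nat ltnW // ltnNge -(log2_le_natl m.+1) // -ltNge.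
by move: hi; rewrite intrD -natr1.
Qed.

Lemma bernoulli_ineq (x : R) T : 0 <= x <= 1 -> 1 - T%:R * x <= (1 - x) ^+ T.
Proof.
move=> /andP[x0 x1]; elim: T => [|T IH]; first by rewrite mul0r subr0 expr0.
have h : (1 - T%:R * x) * (1 - x) <= (1 - x) ^+ T * (1 - x).
  by rewrite ler_wpM2r // subr_ge0.
rewrite exprSr; apply: le_trans h; rewrite -natr1.
suff : 0 <= T%:R * (x * x) by nra.
by rewrite !mulr_ge0.
Qed.

(** Where the minimum is capped at 1 the left side is 0; otherwise this is [1 - a <= expR (- a)]. *)
Lemma subr_min1_le_expRN (a : R) : 0 <= a -> 1 - Num.min a 1 <= expR (- a).
Proof.
move=> a0; case: (leP a 1) => _; first exact: expR_ge1Dx.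
by rewrite subrr expR_ge0.
Qed.

Lemma sum_imset_le (I J : finType) (h : I -> J) (A : {set I}) (F : J -> R) :
  (forall j, 0 <= F j) -> \sum_(j in h @: A) F j <= \sum_(i in A) F (h i).
Proof.
move=> F0; rewrite [leRHS](partition_big_imset h) /=; apply: ler_sum => j.
case/imsetP => i iA ->; rewrite (bigD1 i) ?iA ?eqxx //= lerDl.
by apply: sumr_ge0.
Qed.

End Estimates.

(** * The sample with rates given by rounded degrees *)

Section SampledGraph.
Variables (R : realType) (V : finType) (adj : rel V).
Hypotheses (adj_sym : symmetric adj) (adj_irr : irreflexive adj).
Hypothesis V_gt1 : (1 < #|V|)%N.
Local Notation n := #|V|.
Local Notation L := (log2 (#|V|%:R : R)).
Local Notation rv := (rd_vertex R adj).
Local Notation rde := (rd_edge R adj).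

(* [sample_Pr] restricts the product to the edges; rate 0 elsewhere gives the same
   law on all sets of vertex sets. *)
Definition edge_rate (c : R) (f : {set V}) : R :=
  if f \in edges adj then Num.min (c / rde f) 1 else 0.

Lemma sample_PrE A :
  sample_Pr R adj A = bern_Pr (edge_rate (50 * L ^+ 2)) A.
Proof.
rewrite /sample_Pr /bern_Pr.
rewrite [RHS](bigID (fun S : {set {set V}} => S \subset edges adj)) /=.
rewrite [X in _ = _ + X]big1 ?addr0 => [|S /andP[_ /subsetPn[f fS fE]]]; last first.
  by rewrite /bern_weight (bigD1 f) //= fS /edge_rate (negPf fE) mul0r.
apply: eq_big => [S|S /andP[]]; first by rewrite powersetE andbC.
rewrite powersetE => /subsetP SE _.
rewrite /sample_weight /bern_weight big_mkcond /=; apply: eq_bigr => f _.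
rewrite /edge_rate; case: ifP => // fE.
by case: ifP => [/SE|]; rewrite ?fE ?subr0.
Qed.

Lemma adj_degree_gt0 x y : adj x y -> (0 < degree adj x)%N.
Proof. by move=> xy; apply/card_gt0P; exists y; rewrite inE. Qed.

Lemma rd_edge_adj x y : adj x y -> rde [set x; y] = Num.min (rv x) (rv y).
Proof.
by move=> xy; apply: rd_edgeE; apply: contraTneq xy => ->; rewrite adj_irr.
Qed.

Lemma rd_edge_gt0 f : f \in edges adj -> 0 < rde f.
Proof.
case/imsetP => -[x y]; rewrite inE /= => xy ->; rewrite rd_edge_adj //.
have [rx _ _] := rd_vertex_bounds R (adj_degree_gt0 xy).
have yx : adj y x by rewrite adj_sym.
have [ry _ _] := rd_vertex_bounds R (adj_degree_gt0 yx).
by rewrite lt_min rx.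
Qed.

Lemma log2_card_ge1 : 1 <= L.
Proof. by rewrite (log2_le_natl R 1) // ltnW. Qed.

Lemma edge_rate_bern c : 0 <= c -> is_bern (edge_rate c).
Proof.
move=> c0 f; rewrite /edge_rate; case: ifP => [/rd_edge_gt0 rf|_]; last by rewrite lexx ler01.
by rewrite le_min ler01 divr_ge0 ?(ltW rf) //= ge_min lexx orbT.
Qed.

(** Disjointness makes pairs and edges correspond one to one, and [rde f] is a minimum, hence at
    most [rv x]. *)
Lemma sum_inv_rd_between (B C : {set V}) : [disjoint B & C] ->
  \sum_(x in B) (nbrs adj x C)%:R / rv x <=
  \sum_(f in between adj B C) (rde f)^-1.
Proof.
move=> dBC; rewrite /between big_imset /=; last first.
  move=> [x y] [x' y']; rewrite !inE /= => /and3P[xB yC _] /and3P[x'B y'C _].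
  have notC z : z \in B -> z \in C = false by apply: disjointFr.
  have neq z t : z \in B -> t \in C -> (z == t) = false.
    by move=> zB tC; apply: contraTF tC => /eqP <-; rewrite notC.
  move=> /setP e; have := e x; have := e y; rewrite !inE !eqxx orbT /=.
  rewrite (neq x y') // orbF ![y == x']eq_sym (neq x' y) //=.
  by move=> /esym/eqP -> /esym/eqP ->.
have nbrsE x : (nbrs adj x C)%:R / rv x = \sum_(y | (y \in C) && adj x y) (rv x)^-1.
  rewrite /nbrs natr_sum mulr_suml big_mkcondr; apply: eq_bigr => y _.
  by case: (adj x y); rewrite ?mul1r ?mul0r.
under eq_bigr do rewrite nbrsE.
rewrite pair_big_dep /=.
rewrite [leRHS](eq_bigl (fun p => (p.1 \in B) && ((p.2 \in C) && adj p.1 p.2)));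
  last by move=> p; rewrite inE.
apply: ler_sum => -[x y] /= /and3P[_ _ xy].
have xyE : [set x; y] \in edges adj by apply/imsetP; exists (x, y); rewrite ?inE.
have [rx _ _] := rd_vertex_bounds R (adj_degree_gt0 xy).
rewrite lef_pV2 ?posrE ?rd_edge_gt0 // rd_edge_adj //.
by rewrite ge_min lexx.
Qed.

(** Each edge is charged to both endpoints, and over one sum of ordered pairs a vertex collects
    [degree adj x * (c / rv x) <= 2 * c]. There are two such sums, whence the factor 4. *)
Lemma sum_edge_rate_le c : 0 <= c ->
  \sum_f edge_rate c f <= 4 * c * n%:R.
Proof.
move=> c0; pose F f := if f \in edges adj then c / rde f else 0.
have F0 f : 0 <= F f.
  by rewrite /F; case: ifP => // /rd_edge_gt0 rf; rewrite divr_ge0 // ltW.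
apply: le_trans (_ : \sum_(f in edges adj) F f <= _).
  rewrite [leRHS]big_mkcond /=; apply: ler_sum => f _; rewrite /F /edge_rate.
  by case: ifP => // fE; rewrite ge_min lexx.
apply: le_trans (sum_imset_le _ _ F0) _.
pose G (x y : V) : R := if adj x y then c / rv x else 0.
have sumG : \sum_x \sum_y G x y <= 2 * c * n%:R.
  have -> : 2 * c * n%:R = \sum_(x : V) 2 * c by rewrite sumr_const mulr_natr.
  apply: ler_sum => x _.
  have -> : \sum_y G x y = (degree adj x)%:R * (c / rv x).
    by rewrite -big_mkcond sumr_const mulr_natl /degree cardsE.
  have [->|d0] := posnP (degree adj x); first by rewrite mul0r mulr_ge0.
  have [rx _ dx] := rd_vertex_bounds R d0.
  by rewrite mulrCA -[2 * c]mulrC ler_wpM2l // ler_pdivrMr.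
apply: le_trans (_ : \sum_x \sum_y (G x y + G y x) <= _).
  rewrite pair_big big_mkcond /=; apply: ler_sum => -[x y] _; rewrite inE /=.
  rewrite /G [adj y x]adj_sym; case: ifP => [xy|_]; last by rewrite addr0.
  have xyE : [set x; y] \in edges adj by apply/imsetP; exists (x, y); rewrite ?inE.
  have := rd_vertex_bounds R (adj_degree_gt0 xy).
  have yx : adj y x by rewrite adj_sym.
  have := rd_vertex_bounds R (adj_degree_gt0 yx) => -[ry _ _] [rx _ _].
  rewrite /F xyE rd_edge_adj //.
  have h (z : R) : 0 < z -> 0 <= c / z by move=> z0; rewrite divr_ge0 // ltW.
  by case: (leP (rv x) (rv y)) => _; rewrite ?lerDl ?lerDr h.
under eq_bigr do rewrite big_split.
rewrite big_split /= [X in _ + X]exchange_big /=.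
by apply: le_trans (lerD sumG sumG) _; lra.
Qed.

(** Each factor is at most [expR (- (25 * L / rde f))], and the inverse rounded degrees of these
    edges sum to at least the weight 1/4. *)
Lemma heavy_block_hit (X B : {set V}) : B \subset X ->
  1 / 4 <= \sum_(x in B) (nbrs adj x (X :\: B))%:R / rv x ->
  \prod_(f in between adj B (X :\: B)) (1 - edge_rate (25 * L) f)
    <= expR (- (25 / 4 * L)).
Proof.
move=> BX heavy; have L1 := log2_card_ge1; have L0 : 0 <= 25 * L by lra.
apply: le_trans (_ : \prod_(f in between adj B (X :\: B))
    expR (- (25 * L / rde f)) <= _).
  apply: ler_prod => f fB; have /andP[_ h1] := edge_rate_bern L0 f.
  rewrite subr_ge0 h1 /=.
  have fE : f \in edges adj.
    case/imsetP: fB => -[x y]; rewrite inE => /and3P[_ _ xy] ->.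
    by apply/imsetP; exists (x, y); rewrite ?inE.
  by rewrite /edge_rate fE; apply: subr_min1_le_expRN; rewrite divr_ge0 // ltW ?rd_edge_gt0.
rewrite -expR_sum ler_expR sumrN lerN2 -mulr_sumr.
have dis : [disjoint B & X :\: B] by rewrite disjoints_subset setDE setCI setCK subsetUr.
have := sum_inv_rd_between dis; move: heavy.
set s := \sum_(x in B) _; set t := \sum_(f in _) _ => hs st.
have t4 : 1 / 4 <= t by apply: le_trans hs st.
by nra.
Qed.

(** The full sample dominates [T] rounds: by Bernoulli's inequality, [T] rounds include an edge with
    probability at most [T] times the round's rate, and [T * (25 * L) <= 50 * L ^+ 2]. *)
Lemma edge_rate_rounds T f : (0 < T)%N -> T%:R <= 2 * L ->
  1 - edge_rate (50 * L ^+ 2) f <= (1 - edge_rate (25 * L) f) ^+ T.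
Proof.
move=> T0 TL; have L1 := log2_card_ge1.
have L0 : 0 <= 25 * L by lra.
have /andP[p0 p1] := edge_rate_bern L0 f.
have bernoulli := bernoulli_ineq T (edge_rate_bern L0 f).
have pow_ge0 : 0 <= (1 - edge_rate (25 * L) f) ^+ T.
  by rewrite exprn_ge0 // subr_ge0.
move: p0 p1 bernoulli pow_ge0; rewrite /edge_rate.
case: ifP => [/rd_edge_gt0 rf|_]; last by rewrite mulr0.
case: (leP (50 * L ^+ 2 / rde f) 1) => [a1 _ _ bernoulli _|]; last by rewrite subrr.
apply: le_trans bernoulli; rewrite lerD2l lerN2.
apply: le_trans (_ : T%:R * (25 * L / rde f) <= _).
  by rewrite ler_wpM2l // ge_min lexx.
have ri : 0 < (rde f)^-1 by rewrite invr_gt0.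
rewrite mulrA; apply: ler_wpM2r; first exact: ltW.
by nra.
Qed.

Lemma expRN_le_inv (x y : R) : 0 < y -> y <= expR x -> expR (- x) <= y^-1.
Proof. by move=> y0 yx; rewrite expRN lef_pV2 ?posrE ?expR_gt0. Qed.

Lemma log2_card_ge_ln : ln n%:R <= L.
Proof.
have /andP[_ h1] := ln2_bounds R.
rewrite /log2 ler_pdivlMr ?ln2_gt0 // ler_piMr // ln_ge0 // ler1n ltnW //.
Qed.

(** This is the number of rounds; rounding the logarithm up costs at most 1, and [1 <= L]. *)
Lemma up_log_le : (up_log 2 n)%:R <= 2 * L.
Proof.
have L1 := log2_card_ge1.
have : ((up_log 2 n).-1)%:R <= L.
  by rewrite (log2_le_natl R _ (ltnW V_gt1)); apply: ltnW; exact: up_log_gtn.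
have := up_log_gt0 2 n; rewrite V_gt1; case: (up_log 2 n) => // T _ /=.
by rewrite -natr1; lra.
Qed.

Lemma violated_small :
  bern_Pr (edge_rate (50 * L ^+ 2)) (violated adj setT id) <= 1 / (2 * n%:R).
Proof.
have L1 := log2_card_ge1.
have n2 : 2 <= n%:R :> R by rewrite ler_nat.
(* Start from all of [V] with singleton blocks, that is, labels given by [id]. *)
apply: le_trans (bern_violated adj_sym (p := edge_rate (25 * L))
   (delta := expR (- (25 / 4 * L))) (T := up_log 2 n) (r := rv) _ _ _ _ _ _ _) _.
- move=> x y xy; have [rx rd _] := rd_vertex_bounds R (adj_degree_gt0 xy).
  by rewrite rx.
- by apply: edge_rate_bern; lra.
- exact: expR_ge0.
- exact: heavy_block_hit.
- by apply: edge_rate_bern; nra.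
- by move=> g; apply: edge_rate_rounds; rewrite ?up_log_gt0 ?V_gt1 ?up_log_le.
- by rewrite imset_id cardsT up_logP.
rewrite imset_id cardsT.
(* Uses [25 / 4 >= 4] and [ln n <= L]. The failure bound [2 * n / n ^ 4] is then at most
   [1 / (2 * n)] because [n ^ 2 >= 4]. *)
have : expR (- (25 / 4 * L)) <= (n%:R ^+ 4)^-1.
  apply: expRN_le_inv; first by rewrite exprn_gt0 //; lra.
  rewrite -[n%:R in leLHS]lnK ?posrE; last by lra.
  rewrite -expRM_natl ler_expR.
  by have := log2_card_ge_ln; lra.
move=> h; apply: le_trans (ler_wpM2l _ h) _; first by lra.
rewrite ler_pdivrMr ?exprn_gt0; [|lra..].
rewrite mulrAC ler_pdivlMr; last by lra.
rewrite mul1r.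
have h2 : 4 <= n%:R ^+ 2 :> R by nra.
have -> : n%:R ^+ 4 = n%:R ^+ 2 * n%:R ^+ 2 :> R by rewrite -exprD.
by nra.
Qed.

(** The mean of [2 ^+ #|S|] is at most [expR (200 * n * L ^+ 2)]. As [ln 2 >= 1 / 2], the threshold
    800 takes at least 400 off the coefficient 200, leaving at most -200. *)
Lemma many_edges_small :
  bern_Pr (edge_rate (50 * L ^+ 2))
    (fun S => 800 * (n%:R * L ^+ 2) < #|S|%:R) <= 1 / (2 * n%:R).
Proof.
have L1 := log2_card_ge1.
have n2 : 2 <= n%:R :> R by rewrite ler_nat.
have c0 : 0 <= 50 * L ^+ 2 by nra.
have hp := edge_rate_bern c0.
set a := 800 * _; have /andP[ln2l _] := ln2_bounds R.
apply: le_trans (_ : (\sum_S bern_weight (edge_rate (50 * L ^+ 2)) S * 2 ^+ #|S|) *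
   expR (- (a * ln 2)) <= _).
  rewrite bern_Pr_ind mulr_suml; apply: ler_sum => S _; rewrite -mulrA.
  apply: ler_wpM2l; first exact: bern_weight_ge0.
  have pow2E : 2 ^+ #|S| = expR (#|S|%:R * ln 2) :> R.
    by rewrite expRM_natl lnK ?posrE.
  rewrite pow2E -expRD; case: ltP => hS; last exact: expR_ge0.
  by rewrite -[leLHS]expR0 ler_expR -mulrBl mulr_ge0 ?subr_ge0 ?(ltW hS) // ltW ?ln2_gt0.
rewrite bern_expect_pow2.
apply: le_trans (_ : expR (\sum_f edge_rate (50 * L ^+ 2) f) * expR (- (a * ln 2)) <= _).
  rewrite ler_wpM2r ?expR_ge0 // expR_sum; apply: ler_prod => f _.
  have /andP[p0 _] := hp f; rewrite expR_ge1Dx andbT; lra.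
rewrite -expRD.
have hs := sum_edge_rate_le c0.
have L2 : 1 <= L ^+ 2 by nra.
have nL : n%:R <= n%:R * L ^+ 2 by nra.
apply: le_trans (_ : expR (- (200 * (n%:R * L ^+ 2))) <= _).
  rewrite ler_expR; move: hs; rewrite /a; set s := \sum_f _ => hs.
  by nra.
rewrite mul1r; apply: expRN_le_inv; first by lra.
by apply: le_trans (expR_ge1Dx _); lra.
Qed.

Lemma sampled_graph_whp :
  1 - 1 / n%:R <= sample_Pr R adj (fun S : {set {set V}} =>
        (#|S|%:R <= 800 * (n%:R * L ^+ 2)) &&
        [forall U : {set V}, (n <= #|cut adj U|)%N ==>
           [exists f in cut adj U, f \in S]]).
Proof.
have n2 : 2 <= n%:R :> R by rewrite ler_nat.
have c0 : 0 <= 50 * L ^+ 2 by rewrite mulr_ge0 // sqr_ge0.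
have hp := edge_rate_bern c0.
rewrite sample_PrE bern_PrC lerD2l lerN2.
apply: le_trans (_ : 1 / (2 * n%:R) + 1 / (2 * n%:R) <= _); last first.
  by rewrite !mul1r invfM; lra.
apply: le_trans (lerD many_edges_small violated_small).
apply: le_trans (bern_PrU _ _ hp); apply: bern_Pr_sub => // S /=.
  rewrite negb_and -ltNge; case/orP => [-> //|].
  move=> /forallPn[U]; rewrite negb_imply => /andP[bigU].
  move/exists_inPn => missU; apply/orP; right; apply/existsP; exists U.
  apply/and3P; split; first by apply/consistentP => x y _ _ ->.
  - apply/avoidsP => x y xU yU xy; apply: missU; rewrite inE; apply/andP; split.
      by apply/imsetP; exists (x, y); rewrite ?inE.
    apply/cards1P; exists x; apply/setP => z; rewrite !inE.
    have [->|zx] := eqVneq z x; first by rewrite xU.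
    by apply/negP => /andP[/eqP ->]; apply/negP.
  (* For [X = V] the potential is [n], and the cut has at least [n > 0] edges, so twice their number
     exceeds it. *)
  rewrite setCT ecount0r // cardsT addn0 setTI setTD.
  have le_U := leq_trans bigU (card_cut_leq adj_sym adj_irr U).
  apply: leq_ltn_trans (le_U) _; rewrite ltn_Pmull //.
  exact: leq_trans (ltnW V_gt1) le_U.
Qed.

End SampledGraph.

Theorem theorem2 (R : realType) :
  exists C c : R, 1 <= c /\
    forall (n : nat) (V : finType) (adj : rel V),
      #|V| = n -> (0 < n)%N -> symmetric adj -> irreflexive adj ->
      1 - 1 / (n%:R `^ c) <=
      sample_Pr R adj (fun S : {set {set V}} =>
        (#|S|%:R <= C * (n%:R * log2 (n%:R : R) ^+ 2)) &&
        [forall U : {set V}, (n <= #|cut adj U|)%N ==>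
           [exists f in cut adj U, f \in S]]).
Proof.
exists 800, 1; split=> // n V adj <- n0 adj_sym adj_irr.
rewrite powRr1 //.
(* For [n = 1] the required lower bound is [1 - 1 / 1 = 0]. *)
have [n1|n1] := leqP #|V| 1; last exact: sampled_graph_whp.
have -> : #|V| = 1%N by lia.
rewrite divr1 subrr sample_PrE //; apply: bern_Pr_ge0.
by apply: edge_rate_bern => //; rewrite mulr_ge0 // sqr_ge0.
Qed.
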